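(* Consider Online Bin Packing with Estimated Item Sizes with any accuracy $\delta\in(0,1]$, restricted to input lists $L$ in which no three items fit together into one bin (the sum of the actual sizes of any three items exceeds $1$). On this class of inputs, the algorithm Delayed-Best-Fit (DBF) achieves competitive ratio $\frac43$, i.e., there is a constant $K$ such that $\mathrm{DBF}(L)\le\frac43\,OPT(L)+K$ for all such $L$.
   Context: Online Bin Packing with Estimated Item Sizes: before any item is revealed, the algorithm receives $\delta\in(0,1]$ and an estimated size $c'(a)\in(0,1]$ for each item $a$ of the list $L$ (so it knows the number $n$ of items). Items are then revealed one by one with actual sizes $c(a)\in[c'(a)(1-\delta),\min(c'(a)(1+\delta),1)]$ and must be irrevocably assigned to a bin of capacity $1$ before the next item is revealed; the goal is to minimize the number of bins. $A(L)$ is the number of bins used by $A$ and $OPT(L)$ the optimal number. $A$ is $c$-competitive on a class of inputs if $A(L)\le c\cdot OPT(L)+K$ for a constant $K$ and all $L$ in the class. Best-Fit: place the item into the fullest currently used bin in which it fits; if it fits in no used bin, open a new bin. Delayed-Best-Fit (DBF): let $n$ be the number of announced items. Call an item special if its actual size is at most $\frac12$ and it is among the first $\frac n3$ items of actual size at most $\frac12$ (in order of arrival). When a special item $a$ arrives: if $a$ fits into a bin containing an item of size larger than $\frac12$, pack $a$ into such a bin; otherwise place $a$ into a new empty bin. Every non-special item is packed according to Best-Fit. *)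

(* Defs.v *)
From mathcomp Require Import all_boot all_order all_algebra.
Set Implicit Arguments.
Unset Strict Implicit.
Unset Printing Implicit Defensive.
Import Order.TTheory GRing.Theory Num.Theory.
Local Open Scope ring_scope.

(* An item with its announced estimate c'(a) and its actual size c(a). *)
Record item (R : Type) := Item { est : R; act : R }.

Definition valid_item (R : realFieldType) (delta : R) (a : item R) : bool :=
  [&& 0 < est a <= 1, est a * (1 - delta) <= act a
    & act a <= Num.min (est a * (1 + delta)) 1].

(* A list of items is given in order of arrival. *)
Definition valid_input (R : realFieldType) (delta : R) (L : seq (item R)) :
  bool := (0 < delta <= 1) && all (valid_item delta) L.

Definition actual_sizes (R : Type) (L : seq (item R)) : seq R :=
  [seq act a | a <- L].

Definition no_three_fit (R : realFieldType) (s : seq R) : Prop :=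
  forall i j k : nat, (i < j)%N -> (j < k)%N -> (k < size s)%N ->
    1 < s`_i + s`_j + s`_k.

(* [f] sends each position of [s] to a bin; as many bins as items are offered,
   which is never a restriction on the bins actually used. *)
Definition feasible (R : realFieldType) (s : seq R)
    (f : {ffun 'I_(size s) -> 'I_(size s)}) : bool :=
  [forall b, \sum_(i | f i == b) s`_i <= 1].

(* The default value [size s] of the minimum is attained by giving each item
   its own bin, since item sizes are at most 1. *)
Definition OPT (R : realFieldType) (s : seq R) : nat :=
  \big[minn/size s]_(f | feasible (s := s) f) #|[set f i | i in 'I_(size s)]|.

(* Bins hold the actual sizes of their items; the bins of a packing are listed
   in the order in which they were opened. *)
Definition packing (R : Type) := seq (seq R).

Definition level (R : realFieldType) (b : seq R) : R := \sum_(x <- b) x.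

Definition fits (R : realFieldType) (x : R) (b : seq R) : bool :=
  level b + x <= 1.

Definition small (R : realFieldType) (x : R) : bool := x <= 1 / 2.

Definition has_large (R : realFieldType) (b : seq R) : bool :=
  has (fun y : R => 1 / 2 < y) b.

(* For [i = size P] this opens a new bin containing only [x]. *)
Definition put (R : Type) (x : R) (i : nat) (P : packing R) : packing R :=
  set_nth [::] P i (rcons (nth [::] P i) x).

(* The steps below are relations because neither the ties between equally full
   bins nor the choice among several bins with a large item are prescribed. *)
Definition best_fit_step (R : realFieldType) (x : R) (P P' : packing R) : Prop :=
  (exists2 b : nat, [/\ (b < size P)%N, fits x (nth [::] P b)
       & forall j : nat, (j < size P)%N -> fits x (nth [::] P j) ->
           level (nth [::] P j) <= level (nth [::] P b)]
     & P' = put x b P)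
  \/ ~~ has (fits x) P /\ P' = put x (size P) P.

Definition special_step (R : realFieldType) (x : R) (P P' : packing R) : Prop :=
  (exists2 b : nat, [/\ (b < size P)%N, fits x (nth [::] P b)
       & has_large (nth [::] P b)]
     & P' = put x b P)
  \/ ~~ has (fun b => fits x b && has_large b) P /\ P' = put x (size P) P.

(* [s] lists the items that arrived before [x]: if [x] is the [j]-th small item,
   it is special when [j <= n / 3], that is [3 * j <= n]. *)
Definition special (R : realFieldType) (n : nat) (s : seq R) (x : R) : bool :=
  small x && (3 * (count (@small R) s).+1 <= n)%N.

Definition dbf_step (R : realFieldType) (n : nat) (s : seq R) (x : R)
    (P P' : packing R) : Prop :=
  if special n s x then special_step x P P' else best_fit_step x P P'.

(* [dbf_run n s P]: with [n] announced items, Delayed-Best-Fit can be in the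
   state [P] once the items of actual sizes [s] have arrived in this order. *)
Inductive dbf_run (R : realFieldType) (n : nat) : seq R -> packing R -> Prop :=
| dbf_start : dbf_run n [::] [::]
| dbf_next (s : seq R) (x : R) (P P' : packing R) :
    dbf_run n s P -> dbf_step n s x P P' -> dbf_run n (rcons s x) P'.

(* Main.v *)
(** A bin holds at most two items. Let [l] and [m] be the numbers of large
    (size > 1/2) and small items, [k] the number of special items, and [W] the
    number of bins of DBF without a large item, so that DBF uses [l + W] bins.
    If [t] bins of an optimal packing hold a large and a small item, then
    [2 * OPT >= 2 * l + m - t] and [t <= l].

    If at some moment after the arrival of [n / 3] small items at most one small
    item is alone in its bin, this remains so. Since no two special items share
    a bin, at least [k - W] of them are packed with a large item, hence
    [2 * W <= m - (k - W) + 1], and [k] is about [n / 3]: this suffices.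

    Otherwise all lonely small items are special; let [c] be the smallest.
    Best-Fit combines small items only with the largest lonely one, so the small
    items below [c] are non-special or were packed with a large item; and a large
    item [y] with [y + c <= 1] was packed with a special item. This gives
    [#{small x < c} <= m - W] and [#{large y <= 1 - c} <= k - W]. A large and a
    small item that share a bin satisfy [y <= 1 - c] or [x < c], so
    [t <= m + k - 2 * W], and [3 * k <= l + m] yields the ratio 4/3. *)

Require Import Defs.
From mathcomp Require Import all_boot all_order all_algebra.
From mathcomp Require Import zify lra.
Set Implicit Arguments.
Unset Strict Implicit.
Unset Printing Implicit Defensive.
Import Order.TTheory GRing.Theory Num.Theory.
Local Open Scope ring_scope.

Section DelayedBestFit.
Variable R : realFieldType.
Implicit Types (s : seq R) (P Q : packing R) (b : seq R).

(** * Item classes and the three-item condition *)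

Definition large (x : R) : bool := 1 / 2 < x.

Lemma largeN x : large x = ~~ small x. Proof. exact: ltNge. Qed.

(** Order-free form of [no_three_fit], applicable to three items of a bin wherever they arrived. *)
Definition no_triple s := forall (x y z : R) t,
  perm_eq [:: x, y, z & t] s -> 1 < x + y + z.

Lemma no_three_fit_triple s : no_three_fit s -> no_triple s.
Proof.
move=> s3 x y z t /(perm_iotaP 0)[Is permIs].
case: Is permIs => [|i [|j [|k Is]]] //= permIs [-> -> -> _].
have /and3P[ne_i ne_j _] : [&& i \notin [:: j, k & Is], j \notin k :: Is & true].
  have := iota_uniq 0 (size s); rewrite -(perm_uniq permIs) /=.
  by case/and3P=> -> ->.
have lt h : h \in [:: i, j, k & Is] -> (h < size s)%N.
  by rewrite (perm_mem permIs) mem_iota.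
have [lti ltj ltk]: [/\ i < size s, j < size s & k < size s]%N.
  by split; apply: lt; rewrite !inE eqxx ?orbT.
move: ne_i ne_j; rewrite !inE !negb_or => /and3P[nij nik _] /andP[njk _].
have S (a b c : nat) :
    (a < b)%N -> (b < c)%N -> (c < size s)%N -> 1 < s`_a + s`_b + s`_c.
  exact: s3.
case: (ltngtP i j) nij => // ij _; case: (ltngtP j k) njk => // jk _;
  case: (ltngtP i k) nik => // ik _; try lia.
- by have := S _ _ _ ij jk ltk; lra.
- by have := S _ _ _ ik jk ltj; lra.
- by have := S _ _ _ ik ij ltj; lra.
- by have := S _ _ _ ij ik ltk; lra.
- by have := S _ _ _ jk ik lti; lra.
- by have := S _ _ _ jk ij lti; lra.
Qed.

Lemma no_triple_rcons s x : no_triple (rcons s x) -> no_triple s.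
Proof.
move=> s3 a b c t abct; apply: (s3 a b c (rcons t x)).
by rewrite -!cats1 -!cat_cons perm_cat2r.
Qed.

Definition short_large (c : R) : pred R := [pred y | large y && (y + c <= 1)].
Definition short_small (c : R) : pred R := [pred x | small x && (x < c)].

Lemma short_largeE c y : short_large c y = ~~ small y && (y + c <= 1).
Proof. by rewrite -largeN. Qed.

Lemma short_smallE c x : short_small c x = small x && (x < c).
Proof. by []. Qed.

(** * Kinds of bins and the lower bound for an arbitrary packing *)

Definition single (p : pred R) b : bool := if b is [:: x] then p x else false.
Definition no_large b := ~~ has_large b.
Definition mixed b := (1 < size b)%N && has_large b.

Lemma no_large1 x : no_large [:: x] = small x.
Proof. by rewrite /no_large /has_large /= -/(large x) largeN orbF negbK. Qed.

Lemma no_large2 x y : no_large [:: x; y] = small x && small y.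
Proof.
by rewrite /no_large /has_large /= -!/(large _) !largeN orbF negb_or !negbK.
Qed.

Lemma mixed2 x y : mixed [:: x; y] = ~~ (small x && small y).
Proof. by rewrite -no_large2 /no_large negbK. Qed.

(* The number [t] is the number of bins holding a large and a small item. *)
Lemma packing_bound Q :
    {in Q, forall b, (size b <= 2)%N && (level b <= 1)} ->
  exists t : nat, [/\ (2 * count large (flatten Q) + count (@small R) (flatten Q)
      <= 2 * size Q + t)%N,
    (t <= count large (flatten Q))%N
    & forall c, (t <= count (short_large c) (flatten Q)
                      + count (short_small c) (flatten Q))%N].
Proof.
elim: Q => [|b Q IH] okQ; first by exists 0%N.
have [|t [t1 t2 t3]] := IH; first by move=> b' Qb'; apply: okQ; rewrite inE Qb' orbT.
have /andP[sb lb] := okQ b (mem_head _ _).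
pose tb : nat := has large b && has (@small R) b.
(* All three bounds add up over the bins, so a single bin suffices. *)
suff [b1 b2 b3]: [/\ (2 * count large b + count (@small R) b <= 2 + tb)%N,
    (tb <= count large b)%N
  & forall c, (tb <= count (short_large c) b + count (short_small c) b)%N].
  exists (tb + t)%N; split=> [||c]; rewrite /= !count_cat; try lia.
  by have := b3 c; have := t3 c; lia.
rewrite /tb {tb okQ}.
case: b sb lb => [|x [|y [|]]] //= _; rewrite /level.
  by rewrite largeN /=; case: (small x); split=> // c; lia.
rewrite !big_cons big_nil addr0 => xy.
have nll : ~~ (large x && large y) by rewrite /large; lra.
have Hx c : small x -> large y -> (y + c <= 1) || (x < c).
  by rewrite /small /large; lra.
have Hy c : small y -> large x -> (x + c <= 1) || (y < c).
  by rewrite /small /large; lra.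
split=> [||c]; last first.
  have := Hx c; have := Hy c; rewrite !short_largeE !short_smallE !largeN.
  case: (small x); case: (small y) => //=.
    by move=> _ /(_ isT isT); case: (y + c <= 1); case: (x < c).
  by move=> /(_ isT isT) + _; case: (x + c <= 1); case: (y < c).
all: by move: nll; rewrite !largeN; case: (small x); case: (small y).
Qed.

(** * Shape of the states and steps of DBF *)

Definition proper_state s P :=
  perm_eq (flatten P) s /\ {in P, forall b, (0 < size b <= 2)%N}.

(** A bin with two items cannot receive [x]: the three would fit together. *)
Lemma fits_single s P x i : proper_state s P -> no_triple (rcons s x) ->
    (i < size P)%N -> fits x (nth [::] P i) ->
  exists a P1 P2, [/\ nth [::] P i = [:: a], P = P1 ++ [:: a] :: P2,
    put x i P = P1 ++ [:: a; x] :: P2 & a + x <= 1].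
Proof.
move=> [sP szP] s3 ltb; rewrite /fits /put => fx.
have szb := szP _ (mem_nth [::] ltb).
have defP : P = take i P ++ nth [::] P i :: drop i.+1 P.
  by rewrite -drop_nth // cat_take_drop.
rewrite set_nthE ltb; move: szb fx defP.
move: (take i P) (drop i.+1 P) (nth _ P i) => P1 P2 [|a [|c [|]]] //= _.
  by rewrite /level big_seq1 => ax defP; exists a, P1, P2; split.
rewrite /level !big_cons big_nil addr0 => acx defP.
suff: 1 < a + c + x by rewrite ltNge acx.
apply: (s3 _ _ _ (flatten P1 ++ flatten P2)); apply/permP => p.
by rewrite -cats1 count_cat -(permP sP) defP flatten_cat /= !count_cat /=; lia.
Qed.

Lemma special_div n s x : special n s x = small x && (count (@small R) s < n %/ 3)%N.
Proof. by rewrite /special leq_divRL // mulnC. Qed.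

(** Only lonely items matter: a step either pairs [x] with one of them or shows which of them cannot
    take [x]. *)
Lemma dbf_step_cases n s x P P' : proper_state s P -> no_triple (rcons s x) ->
    dbf_step n s x P P' ->
  (exists a P1 P2, [/\ P = P1 ++ [:: a] :: P2, P' = P1 ++ [:: a; x] :: P2,
      a + x <= 1, special n s x -> large a
    & ~~ special n s x -> forall c, [:: c] \in P -> c + x <= 1 -> c <= a])
  \/ P' = rcons P [:: x] /\
     forall c, [:: c] \in P -> (special n s x -> large c) -> 1 < c + x.
Proof.
move=> okP s3; have putN : put x (size P) P = rcons P [:: x].
  by rewrite /put set_nthE ltnn subnn nth_default // cats1.
rewrite /dbf_step; case: ifP => sx; case.
- case=> b [ltb fb lb] ->; left.
  have [a [P1 [P2 [ea -> -> ax]]]] := fits_single okP s3 ltb fb.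
  by exists a, P1, P2; split=> // _; move: lb; rewrite ea /has_large /= orbF.
- case=> nf ->; right; split=> // c Pc /(_ isT) lc.
  move/hasPn: nf => /(_ _ Pc); rewrite /fits /has_large /level big_seq1 /= orbF.
  by rewrite [1 / 2 < c]lc andbT -ltNge.
- case=> b [ltb fb mb] ->; left.
  have [a [P1 [P2 [ea defP -> ax]]]] := fits_single okP s3 ltb fb.
  exists a, P1, P2; split=> // _ c /(nthP [::])[j ltj ej] cx.
  by have := mb j ltj; rewrite ea ej /fits /level !big_seq1; apply.
- case=> nf ->; right; split=> // c Pc _.
  by move/hasPn: nf => /(_ _ Pc); rewrite /fits /level big_seq1 -ltNge.
Qed.

(** * Invariants of a run *)

Lemma single_join (P1 P2 : packing R) a x c :
  [:: c] \in P1 ++ [:: a; x] :: P2 -> [:: c] \in P1 ++ [:: a] :: P2.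
Proof.
by rewrite !mem_cat !in_cons eqseq_cons andbF => /orP[->|/= ->]; rewrite ?orbT.
Qed.

(** Large items never share a bin; small items are counted bin by bin; the minimum is the number of
    special items so far, which lie in distinct bins. *)
Definition counts_inv n s P :=
  [/\ size P = count large s + count no_large P,
      count (@small R) s + count (single (@small R)) P
        = count mixed P + 2 * count no_large P
    & minn (n %/ 3) (count (@small R) s) <= count mixed P + count no_large P]%N.

(* Stated for every [c] rather than for the lonely small items only, because the
   next special item may become one of any size. *)
Definition early_inv s P :=
  (forall c,
    (count (short_large c) s + count no_large P
      <= count (@small R) s + count (single (short_large c)) P)%N /\
    (count (short_small c) s + count no_large P
      <= count (@small R) s + count (single (short_small c)) P)%N) /\
  forall x y, [:: x] \in P -> [:: y] \in P -> small x -> large y -> 1 < y + x.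

(** First bound: bins without a large item, and large items that fit with [c], involve distinct
    special items. Second: a bin without a large item holds an item not below [c], or just one item
    below [c]. *)
Definition late_inv n s P := forall c, [:: c] \in P -> small c ->
  (count (short_large c) s + count no_large P
    <= minn (n %/ 3) (count (@small R) s))%N /\
  (count (short_small c) s + count no_large P
    <= count (@small R) s + count (single (short_small c)) P)%N.

Definition paired_inv n s P :=
  (n %/ 3 <= count (@small R) s)%N /\ (count (single (@small R)) P <= 1)%N.

(** * Preservation of the invariants *)

Lemma counts_inv_step n s x P P' : proper_state s P -> no_triple (rcons s x) ->
  dbf_step n s x P P' -> counts_inv n s P -> counts_inv n (rcons s x) P'.
Proof.
move=> okP s3 /(dbf_step_cases okP s3) stepP.
rewrite special_div in stepP.
case: stepP => [[a [P1 [P2 [-> -> ax la _]]]] | [-> _]] [];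
  rewrite /counts_inv -!cats1 !size_cat !count_cat /=
    ?no_large1 ?no_large2 ?mixed2 !largeN.
  have nll : ~~ (large a && large x) by rewrite /large; lra.
  move: la nll; rewrite !largeN.
  by case: (small a); case: (small x) => //= la _ i1 i2 i3; split; lia.
by case: (small x) => /= i1 i2 i3; split; lia.
Qed.

(** No lonely large item fits with the lonely [c], so the correction term of the first bound
    vanishes. *)
Lemma early_late n s P : (count (@small R) s <= n %/ 3)%N ->
  early_inv s P -> late_inv n s P.
Proof.
move=> mn [inv maxP] c Pc sc; have [i1 i2] := inv c; split=> //.
suff z : count (single (short_large c)) P = 0%N by rewrite z in i1; lia.
apply/eqP; rewrite -leqn0 leqNgt -has_count; apply/hasPn => -[|y [|]] //= Py.
by apply/negP => /andP[ly]; rewrite leNgt maxP.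
Qed.

(** Here every small item is special, hence never joins another small one. Whichever of a small and
    a large item comes second, it opens a bin only if it does not fit with the lonely other. *)
Lemma early_inv_step n s x P P' : proper_state s P -> no_triple (rcons s x) ->
  dbf_step n s x P P' -> (small x -> count (@small R) s < n %/ 3)%N ->
  early_inv s P -> early_inv (rcons s x) P'.
Proof.
move=> okP s3 /(dbf_step_cases okP s3) stepP mn [inv maxP].
have sx : special n s x = small x.
  by rewrite special_div; case: (small x) mn => //= ->.
rewrite sx in stepP.
case: stepP => [[a [P1 [P2 [defP -> ax la _]]]] | [-> nf]].
  have nll : ~~ (large a && large x) by rewrite /large; lra.
  split=> [c | y z].
    have [] := inv c; rewrite {inv maxP} defP -!cats1 !count_cat /=.
    rewrite !short_largeE !short_smallE !no_large1 !no_large2.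
    move: la nll; rewrite !largeN.
    case: (small a); case: (small x) => //=; try by move=> /(_ isT).
      by move=> _ _; case: (a < c); case: (x + c <= 1); lia.
    by move=> _ _; case: (x < c); case: (a + c <= 1); lia.
  by rewrite defP in maxP; move=> /single_join Py /single_join Pz; apply: maxP.
split=> [c | y z].
  have [] := inv c; rewrite -!cats1 !count_cat /=.
  rewrite !short_largeE !short_smallE !no_large1.
  by case: (small x); case: (x < c); case: (x + c <= 1) => /=; lia.
rewrite !mem_rcons !inE !eqseq_cons !andbT.
case/predU1P=> [->|Py]; case/predU1P=> [->|Pz] //; last exact: maxP.
- by rewrite largeN => ->.
- by move=> sx' lz; apply: nf.
- move=> sy lx; rewrite addrC; apply: nf => // xs.
  by rewrite largeN xs in lx.
Qed.

Lemma late_inv_step n s x P P' : proper_state s P -> no_triple (rcons s x) ->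
  dbf_step n s x P P' -> (small x -> n %/ 3 <= count (@small R) s)%N ->
  late_inv n s P -> late_inv n (rcons s x) P' \/ paired_inv n (rcons s x) P'.
Proof.
move=> okP s3 /(dbf_step_cases okP s3) stepP mn inv.
have sx : special n s x = false.
  by rewrite special_div ltnNge; case: (small x) mn => //= ->.
rewrite sx in stepP.
case: stepP => [[a [P1 [P2 [defP -> ax _ ba]]]] | [-> nf]].
  left=> c Pc sc.
  have nll : ~~ (large a && large x) by rewrite /large; lra.
  have {}Pc : [:: c] \in P by rewrite defP; apply: single_join Pc.
  (* Two small items fit together, so [c] competes with [a] for [x], and Best-Fit prefers the fuller
     bin. *)
  have ca : small x -> c <= a.
    by move=> sx'; apply: ba => //; move: sc sx'; rewrite /small; lra.
  have [] := inv c Pc sc.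
  rewrite {inv} defP -!cats1 !count_cat /=.
  rewrite !short_largeE !short_smallE !no_large1 !no_large2.
  move: ca mn nll; rewrite !largeN.
  case: (small a); case: (small x) => //=.
  - by move=> /(_ isT); rewrite leNgt => /negbTE-> /(_ isT); lia.
  - by move=> _ _ _; case: (a < c); case: (x + c <= 1); lia.
  - by move=> _ /(_ isT) ? _; case: (x < c); lia.
have {}nf c (Pc : [:: c] \in P) : 1 < c + x by apply: nf.
have [xs|lx] := boolP (small x).
  (* A small item opening a bin shows that no small item was lonely, so [x] is now the only one. *)
  right; split; first by rewrite -cats1 count_cat; have := mn xs; lia.
  rewrite -cats1 count_cat /= xs.
  suff z : count (single (@small R)) P = 0%N by rewrite z.
  apply/eqP; rewrite -leqn0 leqNgt -has_count; apply/hasPn => -[|y [|]] //= Py.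
  by apply/negP => sy; have := nf y Py; move: sy xs; rewrite /small; lra.
left=> c; rewrite mem_rcons inE eqseq_cons andbT => /predU1P[->|Pc] sc.
  by rewrite sc in lx.
have [] := inv c Pc sc.
have := nf c Pc; rewrite addrC ltNge => /negbTE xc.
rewrite -!cats1 !count_cat /= !short_largeE !short_smallE !no_large1 xc.
by rewrite (negbTE lx) /=; split; lia.
Qed.

Lemma proper_state_step n s x P P' : proper_state s P -> no_triple (rcons s x) ->
  dbf_step n s x P P' -> proper_state (rcons s x) P'.
Proof.
move=> okP s3 /(dbf_step_cases okP s3); case: okP => sP szP.
case=> [[a [P1 [P2 [defP -> _ _ _]]]] | [-> _]]; split.
- apply/permP => p; rewrite -cats1 count_cat -(permP sP) defP.
  by rewrite !flatten_cat /= !count_cat /=; lia.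
- move=> c; rewrite mem_cat in_cons => /or3P[Pc|/eqP->//|Pc]; apply: szP;
    by rewrite defP mem_cat in_cons Pc ?orbT.
- by rewrite -!cats1 flatten_cat /= perm_cat2r.
- by move=> c; rewrite mem_rcons in_cons => /predU1P[->//|]; apply: szP.
Qed.

(** The alternatives are successive phases; the first two overlap at exactly [n %/ 3] small
    items. *)
Definition dbf_inv n s P :=
  [/\ proper_state s P, counts_inv n s P
    & [\/ (count (@small R) s <= n %/ 3)%N /\ early_inv s P,
          (n %/ 3 <= count (@small R) s)%N /\ late_inv n s P
        | paired_inv n s P]].

Lemma paired_inv_step n s x P P' : proper_state s P -> no_triple (rcons s x) ->
  dbf_step n s x P P' -> paired_inv n s P -> paired_inv n (rcons s x) P'.
Proof.
move=> okP s3 /(dbf_step_cases okP s3) stepP [mn u1].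
have sx : special n s x = false by rewrite special_div ltnNge mn andbF.
rewrite sx in stepP; rewrite /paired_inv -cats1 count_cat.
split; first by lia.
case: stepP => [[a [P1 [P2 [defP -> ax _ ba]]]] | [-> nf]].
  by move: u1; rewrite defP !count_cat /=; lia.
rewrite -cats1 count_cat /=; have [xs|lx] := boolP (small x); last by lia.
suff z : count (single (@small R)) P = 0%N by rewrite z.
apply/eqP; rewrite -leqn0 leqNgt -has_count; apply/hasPn => -[|y [|]] //= Py.
have {}nf : 1 < y + x by apply: nf.
by apply/negP => sy; move: sy xs; rewrite /small; lra.
Qed.

Lemma dbf_run_inv n s P : no_triple s -> dbf_run n s P -> dbf_inv n s P.
Proof.
move=> + run; elim: run => [_|{P}s0 x P P' _ IH stepP s3].
  split; first by split.
    by split; rewrite // minn0.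
  by apply: Or31; split.
have [okP cntP modeP] := IH (no_triple_rcons s3).
split; [exact: proper_state_step stepP | exact: counts_inv_step stepP cntP |].
have late_step : late_inv n s0 P -> (n %/ 3 <= count (@small R) s0)%N ->
    [\/ (count (@small R) (rcons s0 x) <= n %/ 3)%N /\ early_inv (rcons s0 x) P',
        (n %/ 3 <= count (@small R) (rcons s0 x))%N /\ late_inv n (rcons s0 x) P'
      | paired_inv n (rcons s0 x) P'].
  move=> inv mn; have mn' : (n %/ 3 <= count (@small R) (rcons s0 x))%N.
    by rewrite -cats1 count_cat; lia.
  case: (late_inv_step okP s3 stepP _ inv) => // inv'; first exact: Or32.
  exact: Or33.
case: modeP => [[mn inv]|[mn inv]|inv].
- have [lt|ge] := ltnP (count (@small R) s0) (n %/ 3).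
    apply: Or31; split; last exact: early_inv_step stepP _ inv.
    by rewrite -cats1 count_cat /=; case: (small x) => /=; lia.
  by apply: late_step => //; apply: early_late.
- exact: late_step.
- by apply: Or33; apply: paired_inv_step stepP inv.
Qed.

(** * Comparison with an arbitrary packing *)

Lemma min_single P : has (single (@small R)) P ->
  exists c, [/\ [:: c] \in P, small c & count (single (short_small c)) P = 0%N].
Proof.
elim: P => [//|b P IH] /=.
have [/IH [c [Pc sc c0]] _|nP] := boolP (has (single (@small R)) P).
  have [bc|nbc] := boolP (single (short_small c) b); last first.
    by exists c; rewrite in_cons Pc orbT c0 (negbTE nbc); split.
  case: b bc => [|x [|]] //= /andP[sx xc]; exists x.
  rewrite mem_head; split=> //=; rewrite short_smallE ltxx andbF add0n.
  apply/eqP; rewrite -leqn0 -c0; apply: sub_count => -[|y [|]] //=.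
  by case/andP=> sy yx; rewrite short_smallE sy (lt_trans yx).
rewrite orbF; case: b => [|x [|]] //= sx; exists x; rewrite mem_head; split=> //=.
rewrite short_smallE ltxx andbF add0n; apply/eqP; rewrite -leqn0 leqNgt -has_count.
apply: contra nP => /hasP[[|y [|]] // Py /andP[sy _]].
by apply/hasP; exists [:: y].
Qed.

Lemma count_large_small s : (count large s + count (@small R) s = size s)%N.
Proof.
rewrite -(count_predC large); congr addn.
by apply: eq_count => x /=; rewrite largeN negbK.
Qed.

(** The 5 arises when all special items are present and at most one small item is lonely: 3 for that
    item, 2 for rounding in [n %/ 3]. *)
Lemma dbf_inv_bound s P Q : dbf_inv (size s) s P -> perm_eq (flatten Q) s ->
    {in Q, forall b, (size b <= 2)%N && (level b <= 1)} ->
  (3 * size P <= 4 * size Q + 5)%N.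
Proof.
case=> [_ [i1 i2 i3] modeP] sQ okQ.
have cQ (p : pred R) : count p (flatten Q) = count p s by exact/permP.
have [t []] := packing_bound okQ; rewrite !cQ => t1 t2 t3.
have {}t3 c : (t <= count (short_large c) s + count (short_small c) s)%N.
  by have := t3 c; rewrite !cQ.
have lm := count_large_small s.
have late : late_inv (size s) s P -> has (single (@small R)) P ->
    (3 * size P <= 4 * size Q + 5)%N.
  (* The smallest lonely [c] makes the correction term of [late_inv] zero. *)
  move=> inv /min_single[c [Pc sc c0]]; have [j1 j2] := inv c Pc sc.
  by have := t3 c; lia.
have [hasP|] := boolP (has (single (@small R)) P); last first.
  rewrite has_count -leqNgt leqn0 => /eqP u0.
  case: modeP => [[mn [inv _]]|[mn _]|[mn _]]; try lia.
  (* The threshold 1 lies above all small items and leaves no room for a large one, so [t] is at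
     most the number of small items. *)
  have [_ j] := inv 1.
  have : (count (single (short_small 1)) P <= 0)%N.
    rewrite -u0; apply: sub_count => -[|x [|]] //=.
    by rewrite short_smallE => /andP[].
  have s1 : count (short_small 1) s = count (@small R) s.
    apply: eq_count => x; rewrite short_smallE; case: (boolP (small x)) => //=.
    by rewrite /small; lra.
  have l1 : count (short_large 1) s = 0%N.
    rewrite -(count_pred0 s); apply: eq_count => y /=.
    by apply/negP => /andP[]; rewrite /large; lra.
  by have := t3 1; rewrite s1 in j *; lia.
case: modeP => [[mn inv]|[mn inv]|[mn u1]].
- by apply: late => //; apply: early_late.
- exact: late.
- lia.
Qed.

(** * Assignments as lists of bins *)

Definition bins_of s (f : {ffun 'I_(size s) -> 'I_(size s)}) : packing R :=
  [seq [seq s`_i | i : 'I_(size s) <- enum 'I_(size s) & f i == j]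
     | j <- enum [set f i | i in 'I_(size s)]].

Lemma perm_bins_of s (f : {ffun 'I_(size s) -> 'I_(size s)}) :
  perm_eq (flatten (bins_of f)) s.
Proof.
apply/permP => p; rewrite count_flatten sumnE !big_map big_enum /=.
transitivity (\sum_(i < size s) p (s`_i)%R)%N; last first.
  rewrite -sum1_count (big_nth 0) big_mkord [RHS]big_mkcond /=.
  by apply: eq_bigr => i _; case: (p _).
rewrite [RHS](partition_big_imset f) /=; apply: eq_bigr => b _.
rewrite count_map -sum1_count big_filter_cond big_mkcond big_enum [RHS]big_mkcond.
by apply: eq_bigr => i _ /=; case: (f i == b); case: (p _).
Qed.

(** Three items of a bin already exceed 1, and further items only add to the level since sizes are
    nonnegative. *)
Lemma feasible_bins s (f : {ffun 'I_(size s) -> 'I_(size s)}) :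
    no_triple s -> {in s, forall x, 0 <= x} -> feasible f ->
  {in bins_of f, forall b, (size b <= 2)%N && (level b <= 1)}.
Proof.
move=> s3 s0 /forallP ff c Qc; have lc : level c <= 1.
  case/mapP: Qc => b _ ->; rewrite /level big_map big_filter big_enum_cond /=.
  exact: ff.
rewrite lc andbT leqNgt; apply/negP.
have [Q1 [Q2 defQ]] : exists Q1 Q2, bins_of f = Q1 ++ c :: Q2.
  by case/splitPr: Qc => Q1 Q2; exists Q1, Q2.
have perm_c : perm_eq (c ++ flatten (Q1 ++ Q2)) s.
  apply/permP => p; rewrite -(permP (perm_bins_of f)) defQ.
  by rewrite !flatten_cat /= !count_cat; lia.
have c0 : {in c, forall x, 0 <= x}.
  by move=> x cx; apply: s0; rewrite -(perm_mem perm_c) mem_cat cx.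
case: c lc c0 perm_c {Qc defQ} => [|x [|y [|z t]]] //= lc c0 perm_c _.
have xyz := s3 x y z (t ++ _) perm_c.
have t0 : 0 <= \sum_(w <- t) w.
  by rewrite big_seq sumr_ge0 // => w tw; apply: c0; rewrite !in_cons tw !orbT.
by move: lc; rewrite /level !big_cons; lra.
Qed.

End DelayedBestFit.

Theorem theorem4 (R : realFieldType) :
  exists K : R, forall (delta : R) (L : seq (item R)) (P : packing R),
    valid_input delta L ->
    no_three_fit (actual_sizes L) ->
    dbf_run (size L) (actual_sizes L) P ->
    (size P)%:R <= 4 / 3 * (OPT (actual_sizes L))%:R + K.
Proof.
(* The additive 5 of the integral bound, divided by 3. *)
exists (5 / 3) => delta L P /andP[/andP[d0 d1] okL].
have sz : size L = size (actual_sizes L) by rewrite size_map.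
have s0 : {in actual_sizes L, forall x, 0 <= x}.
  apply/allP; rewrite all_map; apply: sub_all okL => a /and3P[/andP[e0 _] + _].
  by apply: le_trans; rewrite mulr_ge0 ?subr_ge0 // ltW.
move: (actual_sizes L) sz s0 => s -> s0 /no_three_fit_triple s3 run.
have inv := dbf_run_inv s3 run.
suff : (3 * size P <= 4 * OPT s + 5)%N.
  rewrite -(ler_nat R) natrD !natrM; lra.
rewrite /OPT; elim/big_ind: _ => [|x y|f ff].
(* The default value [size s] of the minimum: DBF uses at most one bin per item. *)
- case: inv => [_ [i1 i2 _] _].
  have uW : (count (single (@small R)) P <= count (@no_large R) P)%N.
    by apply: sub_count => -[|x [|]] //=; rewrite no_large1.
  by have := count_large_small s; lia.
- by rewrite /minn; case: ifP.
have := dbf_inv_bound inv (perm_bins_of f) (feasible_bins s3 s0 ff).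
(* Only bins in the image of [f] are listed, so their number is the one minimized by [OPT]. *)
by rewrite size_map -cardE.
Qed.
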